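(* Let $p\in(1,\infty)$, $\gamma\in(-1,\infty)$, $m\in[0,\gamma+1)$, $\beta=\frac{\gamma+2}{\gamma+1-m}$, and let $\mathfrak a:\mathbb R^n\to\mathbb R$ be continuous with $0<\lambda_0\le\mathfrak a\le\Lambda_0<\infty$. Let $u$ be a non-negative viscosity solution of $$|\nabla u(x)|^{\gamma}\Delta_p^{\mathrm N}u(x)=\mathfrak a(x)u_+^m(x)\quad\text{in }\mathbb R^n.$$ Then $u\equiv0$ provided that $$\limsup_{|x|\to\infty}\frac{u(x)}{|x|^{\beta}}<\frac1{\beta^{\frac{\gamma+1}{\gamma+1-m}}}\left[\frac{\lambda_0}{n-1+(p-1)(\beta-1)}\right]^{\frac1{\gamma+1-m}}.$$
   Context: $B_r(x)$ is the open ball in $\mathbb R^n$ of radius $r$ centred at $x$; $u_+=\max\{u,0\}$, $u_+^m=(u_+)^m$. The normalized $p$-Laplacian is $\Delta_p^{\mathrm N}u=\Delta u+(p-2)\left\langle D^2u\,\frac{\nabla u}{|\nabla u|},\frac{\nabla u}{|\nabla u|}\right\rangle$. Viscosity solutions of $|\nabla u|^\gamma\Delta_p^{\mathrm N}u=f(x,u)$ in an open set $\Omega$ ($f$ continuous), for continuous $u$: Case $\gamma\ge0$. $u$ is a subsolution (resp. supersolution) if whenever $\phi\in C^2(\Omega)$ and $u-\phi$ has a local maximum (resp. minimum) at $x_0\in\Omega$ with $\phi(x_0)=u(x_0)$: (1) if $\nabla\phi(x_0)\ne0$, then $|\nabla\phi(x_0)|^\gamma\Delta_p^{\mathrm N}\phi(x_0)\ge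 f(x_0,\phi(x_0))$ (resp. $\le$); (2) if $\nabla\phi(x_0)=0$, then for $p\ge2$: $\Delta\phi(x_0)+(p-2)\lambda_{\max}(D^2\phi(x_0))\ge f(x_0,\phi(x_0))$ (resp. $\Delta\phi(x_0)+(p-2)\lambda_{\min}(D^2\phi(x_0))\le f(x_0,\phi(x_0))$), and for $1<p<2$ the same with $\lambda_{\max}$ and $\lambda_{\min}$ interchanged. Here $\lambda_{\max},\lambda_{\min}$ denote the largest and smallest eigenvalues. Case $-1<\gamma<0$. $u$ is a subsolution (resp. supersolution) if for all $\varphi\in C^2(\Omega)$ such that $u-\varphi$ has a local maximum (resp. minimum) at $x_0$, $\varphi(x_0)=u(x_0)$, and $\nabla\varphi(x)\ne0$ for $x\ne x_0$, one has $\lim_{r\to0}\inf_{x\in B_r(x_0),x\ne x_0}\left(-|\nabla\varphi(x)|^\gamma\Delta_p^{\mathrm N}\varphi(x)\right)\le -f(x_0,\varphi(x_0))$ (resp. $\lim_{r\to0}\sup_{x\in B_r(x_0),x\ne x_0}\left(-|\nabla\varphi(x)|^\gamma\Delta_p^{\mathrm N}\varphi(x)\right)\ge -f(x_0,\varphi(x_0))$). A solution is both a subsolution and a supersolution. *)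

(* Defs.v *)
From mathcomp Require Import all_boot all_order all_algebra.
From mathcomp Require Import all_classical all_reals all_analysis.

Set Implicit Arguments.
Unset Strict Implicit.
Unset Printing Implicit Defensive.

Import Order.TTheory GRing.Theory Num.Theory.
Import numFieldNormedType.Exports.

Local Open Scope classical_set_scope.
Local Open Scope ring_scope.

Section Euclidean.
Context {R : realType} {n : nat}.
Implicit Types (x y : 'rV[R]_n) (A : 'M[R]_n) (Om : set 'rV[R]_n)
  (phi : 'rV[R]_n -> R).

Definition dotp x y : R := \sum_(i < n) x 0 i * y 0 i.

(* The library norm `|x| on 'rV[R]_n is the sup norm; it induces the same
   topology, but |x| and the balls below have to be Euclidean. *)
Definition enorm x : R := Num.sqrt (dotp x x).

Definition eball x (r : R) : set 'rV[R]_n := [set y | enorm (y - x) < r].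

Definition at_infty : set_system 'rV[R]_n :=
  filter_from setT (fun r : R => [set x | r < enorm x]).

Definition partial (i : 'I_n) phi x : R := 'D_(delta_mx 0 i) phi x.

Definition grad phi x : 'rV[R]_n := \row_i partial i phi x.

Definition hessian phi x : 'M[R]_n :=
  \matrix_(i, j) partial i (partial j phi) x.

Definition laplacian phi x : R := \tr (hessian phi x).

(* In these two definitions Om is meant to be open: the values of phi outside
   of Om are then irrelevant. *)
Definition C1_on Om phi := forall x, Om x ->
  {for x, continuous phi} /\
  forall i, derivable phi x (delta_mx 0 i) /\ {for x, continuous (partial i phi)}.

Definition C2_on Om phi :=
  C1_on Om phi /\ forall i, C1_on Om (partial i phi).

(* Only used for Hessians of C^2 functions: these are symmetric, so that for
   n > 0 the set of eigenvalues is finite and non-empty. *)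
Definition lambda_max A : R := sup [set a : R | eigenvalue A a].
Definition lambda_min A : R := inf [set a : R | eigenvalue A a].

End Euclidean.

Arguments at_infty : clear implicits.

Section Viscosity.
Context {R : realType} {n : nat}.
Implicit Types (p gamma : R) (f : 'rV[R]_n -> R -> R) (Om : set 'rV[R]_n)
  (u phi : 'rV[R]_n -> R) (x : 'rV[R]_n).

Definition normalized_plaplacian p phi x : R :=
  let nu := (enorm (grad phi x))^-1 *: grad phi x in
  laplacian phi x + (p - 2) * dotp (nu *m hessian phi x) nu.

Definition visc_operator p gamma phi x : R :=
  enorm (grad phi x) `^ gamma * normalized_plaplacian p phi x.

Definition touches_from_above phi u x :=
  (\forall y \near x, u y - phi y <= u x - phi x) /\ phi x = u x.

Definition touches_from_below phi u x :=
  (\forall y \near x, u x - phi x <= u y - phi y) /\ phi x = u x.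

Definition subsolution_nonneg p gamma f Om u :=
  forall phi x0, C2_on Om phi -> Om x0 -> touches_from_above phi u x0 ->
    (grad phi x0 != 0 -> f x0 (phi x0) <= visc_operator p gamma phi x0) /\
    (grad phi x0 = 0 ->
      f x0 (phi x0) <= laplacian phi x0 + (p - 2) *
        (if 2 <= p then lambda_max (hessian phi x0)
         else lambda_min (hessian phi x0))).

Definition supersolution_nonneg p gamma f Om u :=
  forall phi x0, C2_on Om phi -> Om x0 -> touches_from_below phi u x0 ->
    (grad phi x0 != 0 -> visc_operator p gamma phi x0 <= f x0 (phi x0)) /\
    (grad phi x0 = 0 ->
      laplacian phi x0 + (p - 2) *
        (if 2 <= p then lambda_min (hessian phi x0)
         else lambda_max (hessian phi x0)) <= f x0 (phi x0)).

(* In the singular case the infimum and the supremum may be infinite, so they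
   are taken in \bar R; being monotone in r, they have a limit there. *)
Definition subsolution_neg p gamma f Om u :=
  forall phi x0, C2_on Om phi -> Om x0 -> touches_from_above phi u x0 ->
    (forall x, Om x -> x != x0 -> grad phi x != 0) ->
    (lim (ereal_inf [set (- visc_operator p gamma phi x)%:E |
            x in Om `&` eball x0 r `\ x0] @[r --> 0^'+])
      <= (- f x0 (phi x0))%:E)%E.

Definition supersolution_neg p gamma f Om u :=
  forall phi x0, C2_on Om phi -> Om x0 -> touches_from_below phi u x0 ->
    (forall x, Om x -> x != x0 -> grad phi x != 0) ->
    ((- f x0 (phi x0))%:E <=
      lim (ereal_sup [set (- visc_operator p gamma phi x)%:E |
            x in Om `&` eball x0 r `\ x0] @[r --> 0^'+]))%E.

Definition viscosity_subsolution p gamma f Om u :=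
  (forall x, Om x -> {for x, continuous u}) /\
  (if 0 <= gamma then subsolution_nonneg p gamma f Om u
   else subsolution_neg p gamma f Om u).

Definition viscosity_supersolution p gamma f Om u :=
  (forall x, Om x -> {for x, continuous u}) /\
  (if 0 <= gamma then supersolution_nonneg p gamma f Om u
   else supersolution_neg p gamma f Om u).

Definition viscosity_solution p gamma f Om u :=
  viscosity_subsolution p gamma f Om u /\
  viscosity_supersolution p gamma f Om u.

End Viscosity.

(* Main.v *)
Require Import Defs.
From mathcomp Require Import all_boot all_order all_algebra.
From mathcomp Require Import all_classical all_reals all_analysis.
From mathcomp Require Import ring lra.

(* Fix c strictly between the limsup and the critical constant, and compare u
   with the barriers w_y = c |x - y|^beta. By the growth hypothesis u - w_y has
   a global maximum point z. If u y > 0 and z <> y, then w_y, raised by the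
   maximum value, touches u from above at z, where its operator value is
   strictly below lambda0 w_y(z)^m <= a(z) u(z)^m: a contradiction. Hence z = y,
   i.e. u x <= u y + c |x - y|^beta for all x whenever u y > 0. As beta > 1,
   chaining this estimate along a segment shows that every point where u is
   positive is a local maximum of u, and there the equation forces
   a u^m <= 0. *)

Set Implicit Arguments.
Unset Strict Implicit.
Unset Printing Implicit Defensive.

Import Order.TTheory GRing.Theory Num.Theory.
Import numFieldNormedType.Exports.

Local Open Scope classical_set_scope.
Local Open Scope ring_scope.

(** * A class of smooth functions closed under differentiation *)

Section Elementary.
Context {R : realType} {n : nat}.
Implicit Types (f g : 'rV[R]_n -> R) (x v : 'rV[R]_n).

Lemma is_derive_coord x v j : is_derive x v (fun y => y 0 j : R) (v 0 j).
Proof.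
have E : (fun h : R => h^-1 *: ((h *: v + x) 0 j - x 0 j)) @ 0^' --> v 0 j.
  apply: (@cvg_near_cst _ _ _ _ _ _).
  near=> h; rewrite !mxE addrK scalerA mulVf ?scale1r//.
  by near: h; exact: nbhs_dnbhs_neq.
apply: DeriveDef; last exact: cvg_lim E.
by apply/cvg_ex; exists (v 0 j).
Unshelve. all: by end_near. Qed.

(** Only the derivative of [f] along [v] is assumed, so the one-variable chain rule is applied to
    the restriction [k] of [f] to the line through [x] in direction [v]; the difference quotients
    coincide. *)
Lemma is_derive_comp1 (F : R -> R) f x v a d :
  is_derive (f x) 1 F a -> is_derive x v f d ->
  is_derive x v (fun y => F (f y)) (a * d).
Proof.
move=> dF df; pose k (h : R) := f (h *: v + x).
have k0 : k 0 = f x by rewrite /k scale0r add0r.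
have dk : is_derive (0 : R) 1 k d.
  have E : (fun h => h^-1 *: (k (h *: (1 : R) + 0) - k 0)) =
           (fun h => h^-1 *: (f (h *: v + x) - f x)).
    by apply/funext => h; rewrite k0 /k addr0 [h *: 1]mulr1.
  case: df => dfx <-; apply: DeriveDef; last by rewrite /derive /= E.
  by rewrite /derivable /= E.
rewrite -k0 in dF; have := is_derive1_comp dF dk.
have E : (fun h => h^-1 *: ((F \o k) (h *: (1 : R) + 0) - (F \o k) 0)) =
           (fun h => h^-1 *: (F (f (h *: v + x)) - F (f x))).
  by apply/funext => h /=; rewrite k0 /k addr0 [h *: 1]mulr1.
case=> ddF <-; apply: DeriveDef; last by rewrite /derive -E.
by rewrite /derivable -E.
Qed.

(* All test functions below lie in this class, which is stable under partial
   derivatives, so that none of them needs its own C^2 proof. *)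
Inductive elementary : ('rV[R]_n -> R) -> Prop :=
| elem_cst c : elementary (fun=> c)
| elem_coord j : elementary (fun x => x 0 j)
| elemD f g : elementary f -> elementary g -> elementary (fun x => f x + g x)
| elemM f g : elementary f -> elementary g -> elementary (fun x => f x * g x)
| elem_exp f : elementary f -> elementary (fun x => expR (f x)).

Lemma elem_sum (I : Type) (r : seq I) (F : I -> 'rV[R]_n -> R) :
  (forall i, elementary (F i)) -> elementary (fun x => \sum_(i <- r) F i x).
Proof.
move=> eF; elim: r => [|i r IH].
  rewrite (_ : (fun _ => _) = (fun=> 0)); first exact: elem_cst.
  by apply/funext => x; rewrite big_nil.
rewrite (_ : (fun _ => _) = (fun x => F i x + \sum_(j <- r) F j x)).
  by apply: elemD.
by apply/funext => x; rewrite big_cons.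
Qed.

Lemma elem_continuous f : elementary f -> continuous f.
Proof.
elim=> [c|j|{}f g _ cf _ cg|{}f g _ cf _ cg|{}f _ cf] x.
- exact: cst_continuous.
- exact: coord_continuous.
- exact: (cvgD (cf x) (cg x)).
- exact: (cvgM (cf x) (cg x)).
- apply: (@continuous_comp _ _ _ f expR); first exact: cf.
  exact: continuous_expR.
Qed.

Lemma elem_derive f i : elementary f ->
  exists2 g, elementary g & forall x, is_derive x (delta_mx 0 i) f (g x).
Proof.
elim=> [c|j|{}f g ef [f' ef' df] eg [g' eg' dg]
  |{}f g ef [f' ef' df] eg [g' eg' dg]|{}f ef [f' ef' df]].
- exists (fun=> 0); first exact: elem_cst.
  by move=> x; exact: is_derive_cst.
- exists (fun=> (delta_mx 0 i : 'rV[R]_n) 0 j); first exact: elem_cst.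
  by move=> x; exact: is_derive_coord.
- exists (fun x => f' x + g' x); first exact: elemD.
  by move=> x; exact: is_deriveD.
- exists (fun x => f x * g' x + g x * f' x); first by apply: elemD; apply: elemM.
  by move=> x; exact: is_deriveM.
- exists (fun x => expR (f x) * f' x); first by apply: elemM => //; apply: elem_exp.
  by move=> x; apply: is_derive_comp1.
Qed.

Lemma elem_C1 f : elementary f -> C1_on setT f.
Proof.
move=> ef x _; split; first exact: elem_continuous.
move=> i; have [g eg dg] := elem_derive i ef.
split; first by have [] := dg x.
have -> : partial i f = g by apply/funext => y; rewrite /partial derive_val.
exact: elem_continuous.
Qed.

Lemma elem_C2 f : elementary f -> C2_on setT f.
Proof.
move=> ef; split; first exact: elem_C1.
move=> i; have [g eg dg] := elem_derive i ef.
have -> : partial i f = g by apply/funext => y; rewrite /partial derive_val.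
exact: elem_C1.
Qed.

End Elementary.

(** * Euclidean inner product and norm *)

Section Dot.
Context {R : realType} {n : nat}.
Implicit Types (x y z : 'rV[R]_n).

Lemma dotpC x y : dotp x y = dotp y x.
Proof. by apply: eq_bigr => i _; rewrite mulrC. Qed.

Lemma dotpDl x y z : dotp (x + y) z = dotp x z + dotp y z.
Proof. by rewrite -big_split; apply: eq_bigr => i _; rewrite !mxE mulrDl. Qed.

Lemma dotpZl (c : R) x y : dotp (c *: x) y = c * dotp x y.
Proof. by rewrite /dotp mulr_sumr; apply: eq_bigr => i _;
  rewrite !mxE mulrA. Qed.

Lemma dotpDr x y z : dotp x (y + z) = dotp x y + dotp x z.
Proof. by rewrite ![dotp x _]dotpC dotpDl. Qed.

Lemma dotpZr (c : R) x y : dotp x (c *: y) = c * dotp x y.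
Proof. by rewrite ![dotp x _]dotpC dotpZl. Qed.

Lemma dotp0 x : dotp x 0 = 0.
Proof. by rewrite -(scale0r 0) dotpZr mul0r. Qed.

Lemma dotp_sqrD x y :
  dotp (x + y) (x + y) = dotp x x + 2 * dotp x y + dotp y y.
Proof. by rewrite dotpDl !dotpDr (dotpC y x); ring. Qed.

Lemma dotp_ge0 x : 0 <= dotp x x.
Proof. by apply: sumr_ge0 => i _; rewrite -expr2 sqr_ge0. Qed.

Lemma dotp_eq0 x : (dotp x x == 0) = (x == 0).
Proof.
apply/eqP/eqP => [/eqP|->]; last by rewrite /dotp big1 // => i _;
  rewrite mxE mul0r.
rewrite psumr_eq0 => [/allP H|i _]; last by rewrite -expr2 sqr_ge0.
apply/rowP => i; rewrite mxE; apply/eqP.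
by have := H i (mem_index_enum _); rewrite /= mulf_eq0 orbb.
Qed.

Lemma enorm_gt0 x : (0 < enorm x) = (x != 0).
Proof. by rewrite /enorm sqrtr_gt0 lt_def dotp_ge0 dotp_eq0 andbT. Qed.

Lemma sqr_enorm x : enorm x ^+ 2 = dotp x x.
Proof. by rewrite sqr_sqrtr ?dotp_ge0. Qed.

Lemma mul_mx_dotp (e : 'rV[R]_n) x (A : 'M[R]_n) (a b : R) :
  A = a *: (e^T *m e) + b%:M -> x *m A = (a * dotp e x) *: e + b *: x.
Proof.
move=> ->; rewrite mulmxDr mul_mx_scalar -scalemxAr mulmxA; congr (_ + _).
rewrite -scalerA; congr (_ *: _).
have -> : x *m e^T = (dotp e x)%:M.
  apply/matrixP => i j; rewrite !ord1 !mxE eqxx mulr1n.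
  by apply: eq_bigr => k _; rewrite !mxE mulrC.
by rewrite mul_scalar_mx.
Qed.

Lemma continuous_sum_at (I : Type) (r : seq I) (F : I -> 'rV[R]_n -> R) x :
  (forall i, {for x, continuous (F i)}) ->
  {for x, continuous (fun y => \sum_(i <- r) F i y)}.
Proof.
move=> cF; elim: r => [|i r IH].
  rewrite (_ : (fun _ => _) = (fun=> 0)); first exact: cst_continuous.
  by apply/funext => y; rewrite big_nil.
rewrite (_ : (fun _ => _) = (fun y => F i y + \sum_(j <- r) F j y)).
  exact: (cvgD (cF i) IH).
by apply/funext => y; rewrite big_cons.
Qed.

End Dot.

(** * Evaluation and continuity of the operator off critical points *)

Section Operator.
Context {R : realType} {n : nat}.
Implicit Types (phi u : 'rV[R]_n -> R) (x e : 'rV[R]_n) (p gamma : R).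

Lemma enorm_continuous : continuous (@enorm R n).
Proof.
move=> x; apply: (@continuous_comp _ _ _ (fun y : 'rV[R]_n => dotp y y));
  last exact: sqrt_continuous.
apply: continuous_sum_at => i.
exact: (cvgM (@coord_continuous _ _ _ 0 i x) (@coord_continuous _ _ _ 0 i x)).
Qed.

(** The unit vector [e] is an eigenvector of the Hessian with eigenvalue [a + b], and [b] is the
    eigenvalue on its orthogonal complement, of dimension n - 1. Since the gradient points along
    [e], the normalized term raises the weight of that direction from 1 to p - 1. *)
Lemma visc_operator_rank1 p gamma phi x e (g a b : R) :
  0 < g -> dotp e e = 1 -> grad phi x = g *: e ->
  hessian phi x = a *: (e^T *m e) + b%:M ->
  visc_operator p gamma phi x =
  g `^ gamma * ((n%:R - 1) * b + (p - 1) * (a + b)).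
Proof.
move=> g0 e1 Eg EH; rewrite /visc_operator /normalized_plaplacian.
have Ng : enorm (grad phi x) = g.
  by rewrite Eg /enorm dotpZl dotpZr e1 mulr1 -expr2 sqrtr_sqr gtr0_norm.
rewrite Ng Eg scalerA mulVf ?scale1r ?gt_eqF// (mul_mx_dotp e EH) e1 mulr1.
rewrite -scalerDl dotpZl e1 /laplacian EH mxtraceD mxtraceZ mxtrace_scalar.
have -> : \tr (e^T *m e) = 1.
  rewrite -e1; apply: eq_bigr => i _; rewrite !mxE big_ord1 !mxE //.
by rewrite -[b *+ n]mulr_natr; congr (_ * _); ring.
Qed.

Lemma visc_operator_continuous p gamma phi x :
  C2_on setT phi -> grad phi x != 0 ->
  {for x, continuous (visc_operator p gamma phi)}.
Proof.
move=> [C1 C2] gx.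
have cg i : {for x, continuous (fun y => grad phi y 0 i)}.
  rewrite (_ : (fun _ => _) = partial i phi); last by apply/funext => y;
    rewrite mxE.
  by have [_ /(_ i) []] := C1 x I.
have ch i j : {for x, continuous (fun y => hessian phi y i j)}.
  rewrite (_ : (fun _ => _) = partial i (partial j phi));
    last by apply/funext => y; rewrite mxE.
  by have [_ /(_ i) []] := C2 j x I.
have cn : {for x, continuous (fun y => enorm (grad phi y))}.
  apply: (@continuous_comp _ _ _ (fun y => dotp (grad phi y) (grad phi y)));
    last exact: sqrt_continuous.
  by apply: continuous_sum_at => i; exact: (cvgM (cg i) (cg i)).
have nx : 0 < enorm (grad phi x) by rewrite enorm_gt0.
have cv : {for x, continuous (fun y => (enorm (grad phi y))^-1)}.
  exact: (cvgV (lt0r_neq0 nx) cn).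
have cnu i : {for x, continuous
    (fun y => ((enorm (grad phi y))^-1 *: grad phi y) 0 i)}.
  rewrite (_ : (fun _ => _) =
    (fun y => (enorm (grad phi y))^-1 * grad phi y 0 i)).
    exact: (cvgM cv (cg i)).
  by apply/funext => y; rewrite mxE.
have cp : {for x, continuous (fun y => enorm (grad phi y) `^ gamma)}.
  apply: (@continuous_comp _ _ _ (fun y => enorm (grad phi y)) (fun t : R => t
    `^ gamma)).
    exact: cn.
  apply: differentiable_continuous; apply/derivable1_diffP.
  by have [] := is_derive1_powR gamma nx.
have cl : {for x, continuous (laplacian phi)}.
  by apply: continuous_sum_at => i; exact: ch.
have cd : {for x, continuous (fun y =>
    let nu := (enorm (grad phi y))^-1 *: grad phi y in
    dotp (nu *m hessian phi y) nu)}.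
  apply: continuous_sum_at => j.
  rewrite (_ : (fun _ => _) = (fun y =>
    (\sum_i ((enorm (grad phi y))^-1 *: grad phi y) 0 i * hessian phi y i j) *
    ((enorm (grad phi y))^-1 *: grad phi y) 0 j)).
    apply: (cvgM _ (cnu j)).
    by apply: continuous_sum_at => i; exact: (cvgM (cnu i) (ch i j)).
  by apply/funext => y; rewrite mxE.
have ck : {for x, continuous (fun _ : 'rV[R]_n => p - 2)} by exact:
  cst_continuous.
exact: (continuousM cp (continuousD cl (continuousM ck cd))).
Qed.

End Operator.

(** * The subsolution inequality for test functions without critical points *)

Section Sub.
Context {R : realType} {n : nat}.
Implicit Types (phi u : 'rV[R]_n -> R) (x e : 'rV[R]_n) (p gamma : R).

Lemma coord_le_enorm x i : `|x 0 i| <= enorm x.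
Proof.
rewrite -(ler_pXn2r (n := 2)) ?nnegrE ?sqrtr_ge0// sqr_enorm real_normK
  ?num_real//.
rewrite /dotp (bigD1 i)//= -expr2 lerDl.
by apply: sumr_ge0 => j _; rewrite -expr2 sqr_ge0.
Qed.

Lemma nbhs_eball x (A : set 'rV[R]_n) : nbhs x A ->
  exists2 r, 0 < r & eball x r `<=` A.
Proof.
move=> /nbhs_ballP[r /= r0 rA]; exists r => // y; rewrite /eball /= => yr.
apply: rA; split=> // i j; rewrite !ord1 /ball /= distrC.
by have := le_lt_trans (coord_le_enorm (y - x) j) yr; rewrite !mxE.
Qed.

(** The infimum increases as [r] decreases, so the limit exists and dominates every lower bound of
    [F] on a small punctured ball. If [b < l], the midpoint of [b] and [l] is such a bound. *)
Lemma le_lim_inf_eball (F : 'rV[R]_n -> R) x0 (l b : R) :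
  (forall eps, 0 < eps -> exists2 r, 0 < r &
     forall x, eball x0 r x -> x != x0 -> l - eps <= F x) ->
  (lim (ereal_inf [set (F x)%:E | x in setT `&` eball x0 r `\ x0] @[r --> 0^'+])
    <= b%:E)%E ->
  l <= b.
Proof.
move=> lF limb; rewrite leNgt; apply/negP => bl.
have [|r0 r00 r0F] := lF ((l - b) / 2); first lra.
suff : ((l - (l - b) / 2)%:E <= b%:E)%E by rewrite lee_fin; lra.
apply: le_trans limb; apply: lime_ge.
  apply: nonincreasing_at_right_is_cvge; near=> t => r s _ _ rs.
  apply: ereal_inf_le_tmp => _ [x [[_ xr] xx0] <-]; exists x => //; split=> //;
    split=> //.
  exact: lt_le_trans xr rs.
near=> r; apply: le_ereal_inf_tmp => _ [x [[_ xr] xx0] <-].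
rewrite lee_fin; apply: r0F; last exact/eqP.
by apply: (lt_trans xr); near: r; exact: nbhs_right_lt.
Unshelve. all: by end_near. Qed.

(** Treats both signs of [gamma] at once: a test function without critical points is admissible in
    either definition, and for negative [gamma] the continuity of the operator replaces the limit by
    the value at [x0]. *)
Lemma subsolution_test p gamma f u phi x0 :
  viscosity_subsolution p gamma f setT u ->
  C2_on setT phi -> touches_from_above phi u x0 ->
  (forall x, grad phi x != 0) ->
  f x0 (phi x0) <= visc_operator p gamma phi x0.
Proof.
move=> [_]; case: ifP => [_ su|_ su] C2 tc gn;
  first by have [/(_ (gn x0))] := su phi x0 C2 I tc.
have := su phi x0 C2 I tc (fun x _ _ => gn x).
move=> /le_lim_inf_eball H; rewrite -lerN2; apply: H => eps e0.
have /cvgrPdist_le/(_ _ e0)/nbhs_eball[r r0 rF] :=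
  visc_operator_continuous (p := p) (gamma := gamma) C2 (gn x0).
exists r => // x xr _; have := rF x xr; rewrite /= ler_distl; lra.
Qed.

End Sub.

(** * Derivatives of squared distances and of exponential test functions *)

Section Test.
Context {R : realType} {n : nat}.
Implicit Types (f phi u : 'rV[R]_n -> R) (x y z w e : 'rV[R]_n).

Lemma delta_mxE1 i j : (delta_mx 0 i : 'rV[R]_n) 0 j = (j == i)%:R.
Proof. by rewrite mxE eqxx. Qed.

Lemma dotp_delta w i : dotp w (delta_mx 0 i) = w 0 i.
Proof.
rewrite /dotp (bigD1 i)//= delta_mxE1 eqxx mulr1 big1 ?addr0// => j ji.
by rewrite delta_mxE1 (negbTE ji) mulr0.
Qed.

Lemma is_derive_coordB z x i j :
  is_derive x (delta_mx 0 i) (fun y => (y - z) 0 j : R) (j == i)%:R.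
Proof.
rewrite (_ : (fun _ => _) = (fun y => y 0 j + - z 0 j)); last first.
  by apply/funext => y; rewrite !mxE.
apply: is_derive_eq; first exact: (is_deriveD (is_derive_coord _ _ _)
  (is_derive_cst _ _ _)).
by rewrite addr0 delta_mxE1.
Qed.

Lemma is_derive_dotpl w z x i :
  is_derive x (delta_mx 0 i) (fun y => dotp w (y - z)) (w 0 i).
Proof.
rewrite (_ : (fun _ => _) = \sum_(j < n) (fun y => w 0 j * (y - z) 0 j));
  last first.
  by apply/funext => y; rewrite fct_sumE.
apply: is_derive_eq.
  apply: is_derive_sum => j; apply: is_deriveZ; exact: is_derive_coordB.
by rewrite -[RHS]dotp_delta; apply: eq_bigr => j _; rewrite delta_mxE1.
Qed.

Lemma is_derive_sqdist z x i :
  is_derive x (delta_mx 0 i) (fun y => dotp (y - z) (y - z)) (2 * (x - z) 0 i).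
Proof.
rewrite (_ : (fun _ => _) = \sum_(j < n) (fun y => (y - z) 0 j * (y - z) 0 j));
  last first.
  by apply/funext => y; rewrite fct_sumE.
apply: is_derive_eq.
  apply: is_derive_sum => j; apply: is_deriveM; exact: is_derive_coordB.
rewrite -[in RHS](dotp_delta (x - z)) mulr_sumr; apply: eq_bigr => j _.
by rewrite delta_mxE1 /GRing.scale /=; ring.
Qed.

Lemma elem_coordB z j : elementary (fun y : 'rV[R]_n => (y - z) 0 j).
Proof.
rewrite (_ : (fun _ => _) = (fun y => y 0 j + - z 0 j)); last first.
  by apply/funext => y; rewrite !mxE.
by apply: elemD; [exact: elem_coord|exact: elem_cst].
Qed.

Lemma elem_dotpl w z : elementary (fun y => dotp w (y - z)).
Proof.
by apply: elem_sum => j; apply: elemM; [exact: elem_cst|exact: elem_coordB].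
Qed.

Lemma elem_sqdist z : elementary (fun y : 'rV[R]_n => dotp (y - z) (y - z)).
Proof. by apply: elem_sum => j; apply: elemM; exact: elem_coordB. Qed.

Lemma elemX f k : elementary f -> elementary (fun x => f x ^+ k).
Proof.
move=> ef; elim: k => [|k IH]; first exact: elem_cst.
rewrite (_ : (fun _ => _) = (fun x => f x * f x ^+ k)); first exact: elemM.
by apply/funext => x; rewrite exprS.
Qed.

Section Exponential.
Context (M C g1 g2 g3 b : R) (w z : 'rV[R]_n).
Let s x := dotp w (x - z).
Let Q x := g1 * s x + g2 * s x ^+ 2 + g3 * s x ^+ 3 + b * dotp (x - z) (x - z).
Let phi x := M + C * expR (Q x).
(** Derivative of the cubic part of [Q] with respect to [s]. *)
Let dG t := g1 + 2 * g2 * t + 3 * g3 * t ^+ 2.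

Lemma elem_expcubic : elementary phi.
Proof.
have es : elementary s by exact: elem_dotpl.
apply: elemD; first exact: elem_cst.
apply: elemM; first exact: elem_cst.
apply: elem_exp; apply: elemD; last by apply: elemM;
  [exact: elem_cst|exact: elem_sqdist].
apply: elemD; last by apply: elemM; [exact: elem_cst|exact: elemX].
apply: elemD; last by apply: elemM; [exact: elem_cst|exact: elemX].
by apply: elemM; [exact: elem_cst|].
Qed.

Let dQ x i :
  is_derive x (delta_mx 0 i) Q (dG (s x) * w 0 i + 2 * b * (x - z) 0 i).
Proof.
have dG_ (t : R) :
    is_derive t (1 : R) (fun t => g1 * t + g2 * t ^+ 2 + g3 * t ^+ 3) (dG t).
  apply: is_derive_eq; rewrite /dG /GRing.scale /=; ring.
apply: is_derive_eq.
  apply: is_deriveD; first exact: (is_derive_comp1 (dG_ _) (is_derive_dotpl w z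
    x i)).
  by apply: is_deriveZ; exact: is_derive_sqdist.
by rewrite /GRing.scale /=; ring.
Qed.

Let partial_phi i :
  partial i phi =
  fun x => C * expR (Q x) * (dG (s x) * w 0 i + 2 * b * (x - z) 0 i).
Proof.
apply/funext => x; rewrite /partial; apply: derive_val; apply: is_derive_eq.
  apply: is_deriveD; apply: is_deriveZ.
  exact: (is_derive_comp1 (is_derive_expR _) (dQ x i)).
by rewrite /GRing.scale /=; ring.
Qed.

Lemma grad_expcubic x :
  grad phi x = (C * expR (Q x)) *: (dG (s x) *: w + (2 * b) *: (x - z)).
Proof. by apply/rowP => i; rewrite mxE partial_phi !mxE. Qed.

(** At [z] both [s] and [Q] vanish and the gradient of [Q] is [g1 *: w]; the exponential adds the
    square of this gradient to the Hessian of [Q], and [g3] drops out. *)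
Lemma hessian_expcubic :
  hessian phi z = (C * (g1 ^+ 2 + 2 * g2)) *: (w^T *m w) + (2 * b * C)%:M.
Proof.
apply/matrixP => i j; rewrite !mxE big_ord1 !mxE partial_phi /partial;
  apply: derive_val.
have ddG (t : R) : is_derive t (1 : R) dG (2 * g2 + 6 * g3 * t).
  apply: is_derive_eq; rewrite /GRing.scale /=; ring.
have s0 : s z = 0 by rewrite /s subrr dotp0.
have Q0 : Q z = 0 by rewrite /Q s0 subrr dotp0; ring.
apply: is_derive_eq.
  apply: is_deriveM.
    apply: is_deriveZ; exact: (is_derive_comp1 (is_derive_expR _) (dQ z i)).
  apply: is_deriveD; last by apply: is_deriveZ; exact: is_derive_coordB.
  apply: is_deriveM; exact: (is_derive_comp1 (ddG _) (is_derive_dotpl w z z i)).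
have o0 : ord0 = 0 :> 'I_1 by [].
rewrite /GRing.scale /= Q0 expR0 s0 subrr dotp0 !mxE /dG eq_sym o0.
by rewrite -[in RHS](mulr_natr _ (i == j)); ring.
Qed.

End Exponential.

End Test.

(** The difference [D] vanishes at 0 and its derivative t^3 / (1 + t) has the sign of t, so the mean
    value theorem applies on either side. Truncating the Taylor series at odd degree is what gives
    an upper bound for both signs of [s]. *)
Lemma ln1D_le_cubic (R : realType) (s : R) : -1 < s ->
  ln (1 + s) <= s - s ^+ 2 / 2 + s ^+ 3 / 3.
Proof.
move=> s1; pose D (t : R) := t - t ^+ 2 / 2 + t ^+ 3 / 3 - ln (1 + t).
have dD (t : R) : -1 < t -> is_derive t (1 : R) D (t ^+ 3 / (1 + t)).
  move=> t1; have t10 : 0 < 1 + t by lra.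
  have dl := is_derive1_ln t10.
  have d1 : is_derive t (1 : R) (fun y : R => 1 + y) 1.
    have := is_deriveD (is_derive_cst (1 : R) t (1 : R)) (is_derive_id t (1 :
      R)).
    by rewrite add0r.
  have dl' : is_derive t (1 : R) (fun y => ln (1 + y)) ((1 + t)^-1 * 1).
    exact: (is_derive1_comp dl d1).
  have dp : is_derive t (1 : R)
      (fun y : R => y - 2^-1 * y ^+ 2 + 3^-1 * y ^+ 3) (1 - t + t ^+ 2).
    by apply: is_derive_eq; rewrite /GRing.scale /=; field.
  have := is_deriveB dp dl'.
  have -> : (fun y : R => y - 2^-1 * y ^+ 2 + 3^-1 * y ^+ 3) -
            (fun y => ln (1 + y)) = D.
    by apply/funext => y; rewrite /D !fctE; congr (_ - _); field.
  move=> H; apply: is_derive_eq; field; lra.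
have cD (a b : R) : -1 < a -> {within `[a, b], continuous D}.
  move=> a1; apply: continuous_in_subspaceT => t;
    rewrite inE /= in_itv /= => /andP[ta _].
  apply: differentiable_continuous; apply/derivable1_diffP.
  by have [|] := dD t; first lra.
have D0 : D 0 = 0 by rewrite /D addr0 ln1; ring.
suff : 0 <= D s by rewrite /D; lra.
have [s0|s0|->] := ltgtP s 0; last by rewrite D0.
- have [t|c] := MVT s0 (df := fun t => t ^+ 3 / (1 + t)) _ (cD s 0 s1).
    by rewrite in_itv /= => /andP[ts _]; apply: dD; lra.
  rewrite in_itv /= => /andP[cs c0]; rewrite D0.
  have : c ^+ 3 / (1 + c) <= 0.
    rewrite pmulr_lle0 ?invr_gt0; last lra.
    by rewrite exprS pmulr_lle0 ?exprn_even_gt0//= ?lt_eqF//; exact: ltW.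
  nra.
- have [t|c] := MVT s0 (df := fun t => t ^+ 3 / (1 + t)) _ (cD 0 s (ltrN10 R)).
    by rewrite in_itv /= => /andP[ts _]; apply: dD; lra.
  rewrite in_itv /= => /andP[cs c0]; rewrite D0.
  have : 0 <= c ^+ 3 / (1 + c) by rewrite divr_ge0 ?exprn_ge0 ?addr_ge0
    ?ler01// ltW.
  nra.
Qed.

(** * A smooth majorant of the power barrier, used as a test function *)

Section Barrier.
Context {R : realType} {n : nat}.
Implicit Types (f : 'rV[R]_n -> R -> R) (u : 'rV[R]_n -> R) (x y z : 'rV[R]_n).

(* With s = dotp w (x - z), the exponent is beta (s - s^2/2 + s^3/3) plus a
   multiple of the squared distance to the line through y and z. The right-hand
   side has the gradient of the power at z, and its Hessian up to a factor
   1 + eps in the directions orthogonal to z - y. The cubic has derivative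
   1 - s + s^2 > 0, so the gradient vanishes nowhere: this makes it an admissible
   test function also when gamma < 0, whereas the power is critical at y. *)
Lemma enorm_powR_le_expcubic y z (beta eps : R) (r := enorm (z - y))
    (w := r ^- 2 *: (z - y)) :
  z != y -> 0 < beta -> 0 < eps ->
  \forall x \near z, enorm (x - y) `^ beta <= r `^ beta *
    expR (beta * dotp w (x - z)
      + - (beta / 2 + beta / 2 * (1 + eps)) * dotp w (x - z) ^+ 2
      + beta / 3 * dotp w (x - z) ^+ 3
      + beta / 2 * (1 + eps) / r ^+ 2 * dotp (x - z) (x - z)).
Proof.
move=> zy b0 e0; have r0 : 0 < r by rewrite /r enorm_gt0 subr_eq0.
have cs : {for z, continuous (fun x => dotp w (x - z))}.
  exact: elem_continuous (elem_dotpl w z) z.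
have sz : dotp w (z - z) = 0 by rewrite subrr dotp0.
have [d d0 dP] : exists2 d : R, 0 < d &
    forall t, `|t| < d -> -1 < t /\ 1 <= (1 + eps) * (1 + t) ^+ 2.
  (* Chosen so that (1 + eps) (1 - 2 d) = 1; then (1 + t)^2 >= 1 + 2 t suffices. *)
  exists (eps / (2 * (1 + eps))); first by rewrite divr_gt0//; lra.
  have dE : eps / (2 * (1 + eps)) * (2 * (1 + eps)) = eps by rewrite divfK//;
    lra.
  move: dE; set d := eps / _ => dE t; rewrite ltr_norml => /andP[td1 td2].
  have d1 : d < 1 by nra.
  split; first lra.
  have : 1 + eps - 2 * (1 + eps) * d <= (1 + eps) * (1 + 2 * t) by nra.
  have := sqr_ge0 t; nra.
near=> x.
have [s1 s2] : -1 < dotp w (x - z) /\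
    1 <= (1 + eps) * (1 + dotp w (x - z)) ^+ 2.
  apply: dP; near: x; move/cvgrPdist_lt : cs => /(_ _ d0); rewrite /= sz.
  by apply: filterS => x; rewrite sub0r normrN.
set s := dotp w (x - z) in s1 s2 *.
set D := dotp (x - z) (x - z).
have sE : dotp (z - y) (x - z) = r ^+ 2 * s.
  by rewrite /s /w dotpZl mulrA divff ?mul1r// expf_neq0// gt_eqF.
have DE : enorm (x - y) ^+ 2 = r ^+ 2 * (1 + 2 * s) + D.
  rewrite sqr_enorm (_ : x - y = (z - y) + (x - z));
    last by rewrite [RHS]addrC addrA subrK.
  by rewrite dotp_sqrD sE -/D -sqr_enorm -/r; ring.
(* [Z] is the squared distance from [x] to the line through [y] and [z], in units of r^2. *)
pose Z := D / r ^+ 2 - s ^+ 2.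
have DZ : D = r ^+ 2 * (Z + s ^+ 2) by rewrite /Z subrK mulrC divfK//
  expf_neq0// gt_eqF.
have Z0 : 0 <= Z.
  have := dotp_ge0 ((x - z) + - s *: (z - y)).
  rewrite dotp_sqrD dotpZl !dotpZr (dotpC (x - z) (z - y)) sE -/D -sqr_enorm
    -/r DZ.
  rewrite [X in 0 <= X -> _](_ : _ = r ^+ 2 * Z); last by ring.
  by rewrite pmulr_rge0// exprn_gt0.
(* Pythagoras, factored so that the logarithm splits into a radial and a transversal term. *)
have E2 : enorm (x - y) ^+ 2 = r ^+ 2 * ((1 + s) ^+ 2 * (1 + Z / (1 + s) ^+ 2)).
  by rewrite DE DZ; field; lra.
have s10 : 0 < 1 + s by lra.
have s12 : 0 < (1 + s) ^+ 2 by rewrite exprn_gt0.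
have F0 : 0 < 1 + Z / (1 + s) ^+ 2 by rewrite ltr_wpDr// divr_ge0// ltW.
have N0 : 0 < enorm (x - y).
  rewrite lt_def sqrtr_ge0 andbT; apply/eqP => H; move: E2; rewrite H expr0n /=.
  by apply/eqP; rewrite lt_eqF// !mulr_gt0// exprn_gt0.
rewrite /powR !gt_eqF// -expRD ler_expR.
have L2 : ln (enorm (x - y)) + ln (enorm (x - y)) =
    (ln r + ln r) + (ln (1 + s) + ln (1 + s) + ln (1 + Z / (1 + s) ^+ 2)).
  by rewrite -![ln _ + ln _]mulr2n -!lnXn// E2 !lnM ?posrE ?mulr_gt0//
    exprn_gt0.
have L3 := ln1D_le_cubic s1.
(* The factor [1 + eps] absorbs the variation of (1 + s)^2 near [z], leaving a bound quadratic in
   [x]. *)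
have L4 : ln (1 + Z / (1 + s) ^+ 2) <= (1 + eps) * Z.
  apply: (le_trans (le_ln1Dx _)).
    by apply: (@lt_le_trans _ _ 0); [lra|rewrite divr_ge0// ltW].
  rewrite ler_pdivrMr//; nra.
have H : ln (enorm (x - y)) <=
    ln r + (s - s ^+ 2 / 2 + s ^+ 3 / 3) + (1 + eps) * Z / 2 by lra.
have := ler_wpM2l (ltW b0) H; congr (_ <= _).
by rewrite DZ; field; rewrite gt_eqF.
Unshelve. all: by end_near. Qed.

(** The smooth majorant of the power agrees with it at [z], so after the same vertical shift it
    still touches [u] from above there. In the Hessian the [eps] terms cancel in the radial
    direction and survive only in the n - 1 tangential ones. *)
Lemma subsolution_touching_power (p gamma : R) f u (beta c eps : R) y z
    (r := enorm (z - y)) :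
  viscosity_subsolution p gamma f setT u ->
  z != y -> 0 < c -> 0 < beta -> 0 < eps ->
  (\forall x \near z, u x - c * enorm (x - y) `^ beta <=
                      u z - c * r `^ beta) ->
  f z (u z) <= (c * r `^ beta * beta / r) `^ gamma *
    (c * r `^ beta * beta / r ^+ 2) *
    ((n%:R - 1) * (1 + eps) + (p - 1) * (beta - 1)).
Proof.
move=> su zy c0 b0 e0 tc; have r0 : 0 < r by rewrite /r enorm_gt0 subr_eq0.
have := enorm_powR_le_expcubic zy b0 e0; rewrite -/r /=.
set w := r ^- 2 *: (z - y); set g2 := - (_ + _); set g3 := beta / 3.
set b := _ / r ^+ 2 => le_exp.
have ww : dotp w w = r ^- 2.
  by rewrite /w dotpZl dotpZr -sqr_enorm -/r; field; rewrite gt_eqF.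
clearbody w.
pose C := c * r `^ beta; pose M := u z - C.
have C0 : 0 < C by rewrite mulr_gt0// powR_gt0.
pose phi x := M + C * expR (beta * dotp w (x - z) + g2 * dotp w (x - z) ^+ 2
  + g3 * dotp w (x - z) ^+ 3 + b * dotp (x - z) (x - z)).
have sz : dotp w (z - z) = 0 by rewrite subrr dotp0.
have dz : dotp (z - z) (z - z) = 0 by rewrite subrr dotp0.
have phiz : phi z = u z.
  by rewrite /phi sz dz !expr0n /= !mulr0 !addr0 expR0 mulr1 /M subrK.
have gradE x : grad phi x =
    (C * expR (beta * dotp w (x - z) + g2 * dotp w (x - z) ^+ 2
       + g3 * dotp w (x - z) ^+ 3 + b * dotp (x - z) (x - z))) *:
    ((beta + 2 * g2 * dotp w (x - z) + 3 * g3 * dotp w (x - z) ^+ 2) *: w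
       + (2 * b) *: (x - z)).
  exact: grad_expcubic.
rewrite -phiz.
have tch : touches_from_above phi u z.
  split; last exact: phiz.
  rewrite phiz subrr; near=> x; rewrite subr_le0.
  have H1 : u x - c * enorm (x - y) `^ beta <= M by near: x; exact: tc.
  have : enorm (x - y) `^ beta <= r `^ beta * expR (beta * dotp w (x - z)
     + g2 * dotp w (x - z) ^+ 2 + g3 * dotp w (x - z) ^+ 3
     + b * dotp (x - z) (x - z)) by near: x; exact: le_exp.
  by move=> /(ler_wpM2l (ltW c0)); rewrite [leRHS]mulrA -/C => H2;
    rewrite /phi; lra.
(* The component along [w] is enough: up to a positive factor it is 1 - s + s^2, the [eps] terms
   cancelling. *)
have gn0 x : grad phi x != 0.
  apply/eqP => /(congr1 (dotp w));
    rewrite gradE dotpZr (dotpDr w (_ *: w)) !dotpZr ww dotp0.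
  apply/eqP; rewrite gt_eqF// mulr_gt0// ?(mulr_gt0 C0) ?expR_gt0//.
  set s := dotp w (x - z).
  rewrite (_ : _ + _ = beta / r ^+ 2 * (1 - s + s ^+ 2)); last first.
    by rewrite /g2 /g3 /b; field; rewrite gt_eqF.
  rewrite !mulr_gt0 ?invr_gt0 ?exprn_gt0//; have := sqr_ge0 (s - 1 / 2); nra.
have C2 : C2_on setT phi by apply: elem_C2; exact: elem_expcubic.
apply: le_trans (subsolution_test su C2 tch gn0) _.
(* The unit vector is [r *: w], because [w] has norm 1 / r. *)
rewrite (@visc_operator_rank1 _ _ _ _ _ _ (r *: w) (C * beta / r)
   (C * (beta ^+ 2 + 2 * g2) / r ^+ 2) (2 * b * C)).
- rewrite -/C -[leRHS]mulrA le_eqVlt; apply/orP; left; apply/eqP; congr (_ * _).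
  by rewrite /b /g2; field; rewrite gt_eqF.
- by rewrite divr_gt0// mulr_gt0.
- by rewrite dotpZl dotpZr ww; field; rewrite gt_eqF.
- rewrite gradE sz dz subrr scaler0 addr0 !expr0n /= !mulr0 !addr0 expR0 mulr1.
  by rewrite !scalerA; congr (_ *: _); field; rewrite gt_eqF.
- rewrite hessian_expcubic; congr (_ + _).
  have -> : (r *: w)^T = r *: w^T by apply/matrixP => i j; rewrite !mxE.
  rewrite -scalemxAl -scalemxAr !scalerA; congr (_ *: _).
  by field; rewrite gt_eqF.
Unshelve. all: by end_near. Qed.

End Barrier.

(** * The equation at a local maximum *)

Section LocalMax.
Context {R : realType} {n : nat}.
Implicit Types (f : 'rV[R]_n -> R -> R) (u : 'rV[R]_n -> R) (x y z : 'rV[R]_n).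

(** Serves to evaluate [lambda_max] and [lambda_min] on the zero Hessian of a constant; in dimension
    0 the set would be empty. *)
Lemma eigenvalue0 : (0 < n)%N ->
  [set a : R | eigenvalue (0 : 'M[R]_n) a] = [set 0].
Proof.
case: n => // n' _; apply/seteqP; split => a /=.
  move=> /eigenvalueP[v + v0]; rewrite mulmx0 => /esym/eqP.
  by rewrite scaler_eq0 (negbTE v0) orbF => /eqP.
move=> ->; apply/eigenvalueP; exists (const_mx 1);
  first by rewrite mulmx0 scale0r.
by apply/eqP => /rowP/(_ 0); rewrite !mxE => /eqP; rewrite oner_eq0.
Qed.

Lemma elem_powsqdist (M : R) k z :
  elementary (fun x => M + dotp (x - z) (x - z) ^+ k).
Proof. by apply: elemD; [exact: elem_cst|apply: elemX; exact: elem_sqdist]. Qed.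

Lemma is_derive_pow (F : 'rV[R]_n -> R) k x v d : is_derive x v F d ->
  is_derive x v (fun y => F y ^+ k) (k%:R * F x ^+ k.-1 * d).
Proof.
move=> dF; have -> : (fun y => F y ^+ k) = F ^+ k.
  apply/funext => y; elim: k => [|k IH]; first by rewrite !expr0.
  by rewrite !exprS IH.
exact: is_deriveX.
Qed.

Lemma partial_powsqdist (M : R) k z i :
  partial i (fun x => M + dotp (x - z) (x - z) ^+ k.+1) =
  fun x => 2 * k.+1%:R * dotp (x - z) (x - z) ^+ k * (x - z) 0 i.
Proof.
apply/funext => x; rewrite /partial; apply: derive_val; apply: is_derive_eq.
  apply: is_deriveD; apply: is_derive_pow; exact: is_derive_sqdist.
by rewrite /GRing.scale /=; ring.
Qed.

Lemma rank1D_scalarE (a b : R) (w : 'rV[R]_n) i j :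
  (a *: (w^T *m w) + b%:M) i j = a * (w 0 i * w 0 j) + b * (i == j)%:R.
Proof. by rewrite !mxE big_ord1 !mxE mulr_natr. Qed.

Lemma hessian_powsqdist (M : R) k z x :
  hessian (fun x => M + dotp (x - z) (x - z) ^+ k.+2) x =
  (4 * k.+2%:R * k.+1%:R * dotp (x - z) (x - z) ^+ k) *:
    ((x - z)^T *m (x - z)) +
  (2 * k.+2%:R * dotp (x - z) (x - z) ^+ k.+1)%:M.
Proof.
apply/matrixP => i j; rewrite [LHS]mxE partial_powsqdist /partial;
  apply: derive_val.
apply: is_derive_eq.
  apply: is_deriveM; last exact: is_derive_coordB.
  by apply: is_deriveZ; apply: is_derive_pow; exact: is_derive_sqdist.
by rewrite rank1D_scalarE eq_sym /GRing.scale /=; ring.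
Qed.

(* For gamma < 0 the constant test function is not admissible; it is replaced by
   u z + |x - z|^(2 (k + 2)), with k so large that its operator value, of order
   |x - z|^((2 k + 3) (gamma + 1) - 1), tends to 0. *)
Lemma subsolution_local_max (p gamma : R) f u z :
  (0 < n)%N -> 1 < p -> -1 < gamma ->
  viscosity_subsolution p gamma f setT u ->
  (\forall x \near z, u x <= u z) -> f z (u z) <= 0.
Proof.
move=> n0 p1 g1 [_]; case: ifP => [_ su umax|_ su umax].
  (* For [gamma >= 0] the constant [u z] is admissible, through the clause for vanishing
     gradient. *)
  pose phi := (fun=> u z) : 'rV[R]_n -> R.
  have Dphi i : partial i phi = fun=> 0.
    by apply/funext => x; rewrite /partial; apply: derive_val;
      exact: is_derive_cst.
  have C2 : C2_on setT phi by apply: elem_C2; exact: elem_cst.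
  have tc : touches_from_above phi u z.
    by split=> //; rewrite /phi subrr; near=> x; rewrite subr_le0; near: x.
  have H0 : hessian phi z = 0.
    apply/matrixP => i j; rewrite !mxE Dphi /partial.
    by apply: derive_val; exact: is_derive_cst.
  have G0 : grad phi z = 0 by apply/rowP => i; rewrite !mxE Dphi.
  have [_ /(_ G0)] := su phi z C2 I tc.
  rewrite /laplacian H0 mxtrace0 /lambda_max /lambda_min eigenvalue0// sup1
    inf1.
  by rewrite if_same mulr0 addr0.
have [k kP] : exists k : nat, 0 < (2 * k%:R + 3) * (gamma + 1) - 1.
  (* With k > 1 / (gamma + 1), already 2 k (gamma + 1) exceeds 2. *)
  exists (Num.bound ((gamma + 1)^-1)).
  have gp : 0 < gamma + 1 by lra.
  have := archi_boundP (ltW (divr_gt0 ltr01 gp)); rewrite div1r => H.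
  have : (gamma + 1) * (gamma + 1)^-1 = 1 by rewrite divff// gt_eqF.
  move: H; set N := (Num.bound _)%:R; set q := _^-1 => H E.
  have q0 : 0 < q by rewrite invr_gt0.
  nra.
set sigma := _ - 1 in kP.
pose phi x := u z + dotp (x - z) (x - z) ^+ k.+2.
have phiz : phi z = u z by rewrite /phi subrr dotp0 expr0n addr0.
have gradE x :
    grad phi x = (2 * k.+2%:R * dotp (x - z) (x - z) ^+ k.+1) *: (x - z).
  by apply/rowP => i; rewrite [LHS]mxE [RHS]mxE partial_powsqdist.
have xz0 x : x != z -> 0 < enorm (x - z) by rewrite enorm_gt0 subr_eq0.
have C2 : C2_on setT phi by apply: elem_C2; exact: elem_powsqdist.
have tc : touches_from_above phi u z.
  split=> //; rewrite phiz subrr; near=> x; rewrite subr_le0.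
  apply: (@le_trans _ _ (u z)); first by near: x.
  by rewrite lerDl exprn_ge0// dotp_ge0.
have gn0 x : setT x -> x != z -> grad phi x != 0.
  move=> _ /xz0 x0; rewrite gradE scaler_eq0 negb_or.
  by rewrite -enorm_gt0 x0 andbT gt_eqF// mulr_gt0 ?mulr_gt0// exprn_gt0//
    -sqr_enorm exprn_gt0.
(* The tangential eigenvalues of the Hessian are 2 (k + 2) |x - z|^(2 k + 2), and the radial one is
   2 k + 3 times as large. *)
pose K := (2 * k.+2%:R) `^ gamma * (2 * k.+2%:R) *
  ((n%:R - 1) + (p - 1) * (2 * k%:R + 3)).
have n1 : (1 : R) <= n%:R by rewrite ler1n.
have K0 : 0 < K.
  rewrite mulr_gt0 ?mulr_gt0 ?powR_gt0 ?mulr_gt0//.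
  have : (0 : R) <= k%:R by []. nra.
have viscE x : x != z ->
    visc_operator p gamma phi x = K * enorm (x - z) `^ sigma.
  move=> xz; have h0 := xz0 _ xz; set h := enorm (x - z) in h0 *.
  have DE : dotp (x - z) (x - z) = h ^+ 2 by rewrite -sqr_enorm.
  have hn0 : h != 0 by rewrite gt_eqF.
  have P1 : (h ^+ 2) ^+ k.+1 = h ^+ (2 * k + 2) by rewrite -exprM mulnS addnC.
  have P3 : h ^+ (2 * k + 3) = h ^+ (2 * k + 2) * h by rewrite -exprSr addnS.
  rewrite (@visc_operator_rank1 _ _ _ _ _ _ (h^-1 *: (x - z))
     (2 * k.+2%:R * h ^+ (2 * k + 3))
     (4 * k.+2%:R * k.+1%:R * h ^+ (2 * k + 2))
     (2 * k.+2%:R * h ^+ (2 * k + 2))).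
  - rewrite powRM ?mulr_ge0 ?exprn_ge0// ?ltW// -powR_mulrn ?ltW// -powRrM.
    rewrite -[h ^+ (2 * k + 2)]powR_mulrn ?ltW//.
    rewrite (_ : sigma = (2 * k + 3)%:R * gamma + (2 * k + 2)%:R); last first.
      by rewrite /sigma !natrD; ring.
    rewrite [in RHS]powRD ?hn0 ?implybT// /K; ring.
  - by rewrite !mulr_gt0// exprn_gt0.
  - by rewrite dotpZl dotpZr DE; field.
  - rewrite gradE DE scalerA; congr (_ *: _).
    by rewrite P1 P3; field.
  - rewrite hessian_powsqdist DE; congr (_ + _); last first.
      by rewrite P1.
    have -> : (h^-1 *: (x - z))^T = h^-1 *: (x - z)^T by apply/matrixP => i j;
      rewrite !mxE.
    rewrite -scalemxAl -scalemxAr !scalerA; congr (_ *: _).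
    by rewrite -P1 [_ ^+ k.+1]exprSr; field.
have := su phi z C2 I tc gn0.
move=> /le_lim_inf_eball; rewrite phiz => H; rewrite -oppr_ge0;
  apply: H => eps e0.
(* The radius at which K r^sigma equals [eps]. *)
exists ((eps / K) `^ sigma^-1) => [|x xr xz];
  first by rewrite powR_gt0 ?divr_gt0.
rewrite sub0r lerN2 viscE// mulrC -ler_pdivlMr//.
have : enorm (x - z) `^ sigma < ((eps / K) `^ sigma^-1) `^ sigma.
  by apply: gt0_ltr_powR => //; rewrite nnegrE ?powR_ge0 ?sqrtr_ge0.
by rewrite -powRrM mulVf ?gt_eqF// powRr1 ?divr_ge0 ?(ltW e0) ?(ltW K0)// =>
  /ltW.
Unshelve. all: by end_near. Qed.

End LocalMax.

(** * Global maxima against the barrier, and the chaining argument *)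

Section Global.
Context {R : realType} {n : nat}.
Implicit Types (f : 'rV[R]_n -> R -> R) (u : 'rV[R]_n -> R) (x y z : 'rV[R]_n).

Lemma enorm_dist_continuous y : continuous (fun x : 'rV[R]_n => enorm (x - y)).
Proof.
move=> x; apply: (@continuous_comp _ _ _ (fun x => dotp (x - y) (x - y))).
  exact: elem_continuous (elem_sqdist y) x.
exact: sqrt_continuous.
Qed.

(** The derivative of a real power covers only positive bases, hence [x != y]; at [y] itself the
    tolerance [e] is met as soon as the norm is below e^(1 / beta). *)
Lemma enorm_powR_continuous (beta : R) y : 0 < beta ->
  continuous (fun x : 'rV[R]_n => enorm (x - y) `^ beta).
Proof.
move=> b0 x; have cn := @enorm_dist_continuous y x.
have [xy|xy] := eqVneq x y.
  apply/(@cvgrPdist_lt _ R^o _ (nbhs x) (nbhs_filter x)) => e e0.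
  have e0' : 0 < e `^ beta^-1 by rewrite powR_gt0.
  move/cvgrPdist_lt : cn => /(_ _ e0'); apply: filterS => t /=.
  have E0 : enorm (x - y) = 0 by rewrite xy subrr /enorm dotp0 sqrtr0.
  rewrite E0 powR0 ?gt_eqF// !sub0r !normrN.
  rewrite !ger0_norm ?powR_ge0 ?sqrtr_ge0// => H.
  have : enorm (t - y) `^ beta < (e `^ beta^-1) `^ beta.
    by apply: gt0_ltr_powR => //; rewrite nnegrE ?powR_ge0 ?sqrtr_ge0.
  by rewrite -powRrM mulVf ?gt_eqF// powRr1 // (ltW e0).
apply: (@continuous_comp _ _ _ (fun x => enorm (x - y)) (fun t : R => t `^
  beta)); first exact: cn.
apply: differentiable_continuous; apply/derivable1_diffP.
have N0 : 0 < enorm (x - y) by rewrite enorm_gt0 subr_eq0.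
by have [] := is_derive1_powR beta N0.
Qed.

Lemma compact_enorm_ball (r : R) : compact [set x : 'rV[R]_n | enorm x <= r].
Proof.
apply: bounded_closed_compact.
  exists r; split; first exact: num_real.
  move=> M rM x /= xr; rewrite [leLHS]mx_normrE.
  have M0 : 0 <= M by apply: le_trans (ltW rM); apply: le_trans xr;
    exact: sqrtr_ge0.
  apply/bigmax_leP; split=> // -[i j] _ /=; rewrite ord1.
  by apply: le_trans (ltW rM); apply: le_trans xr; exact: coord_le_enorm.
rewrite (_ : [set x | _] = (@enorm R n) @^-1` [set t | t <= r])//.
by apply: closed_comp; [move=> x _; exact: enorm_continuous|exact: closed_le].
Qed.

(* Coercivity: Young's inequality gives [|x - y|^2 >= theta^2 |x|^2] for large
   [|x|] whenever [theta < 1], so [u] is eventually below the barrier. *)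
Lemma power_barrier_max u y (beta c0 c R0 : R) :
  continuous u -> (forall x, 0 <= u x) -> 0 < beta -> 0 < c0 -> c0 < c ->
  (forall x, R0 < enorm x -> u x <= c0 * enorm x `^ beta) ->
  exists z, forall x,
    u x - c * enorm (x - y) `^ beta <= u z - c * enorm (z - y) `^ beta.
Proof.
move=> cu u0 b0 c00 c0c ub.
have cp : 0 < c by lra.
(* With this [th], c0 |x|^beta = c (th |x|)^beta, so the comparison of barriers becomes th |x| <= |x
   - y|. *)
pose th := (c0 / c) `^ beta^-1.
have thb : th `^ beta = c0 / c.
  by rewrite /th -powRrM mulVf ?gt_eqF// powRr1// ltW// divr_gt0.
have th0 : 0 <= th by exact: powR_ge0.
have th1 : th < 1.
  have : th < 1 `^ beta^-1.
    apply: gt0_ltr_powR; rewrite ?invr_gt0// ?nnegrE ?divr_ge0 ?(ltW c00) ?(ltW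
      cp)//.
    by rewrite ltr_pdivrMr// mul1r.
  by rewrite powR1.
(* Thus th^2 = 1 - 2 eta. In |x - y|^2, Young's inequality bounds the cross term by eta |x|^2 +
   |y|^2 / eta, and the last summand is at most eta |x|^2 once |y| <= eta |x|. *)
pose eta := (1 - th ^+ 2) / 2.
have eta0 : 0 < eta by rewrite /eta; nra.
pose R1 := Num.max R0 (Num.max (enorm y) (enorm y / eta)).
have far x : R1 < enorm x -> u x <= c * enorm (x - y) `^ beta.
  rewrite /R1 !gt_max => /and3P[xR0 _ xe].
  apply: le_trans (ub _ xR0) _.
  have -> : c0 = c * th `^ beta by rewrite thb mulrC divfK// gt_eqF.
  rewrite -mulrA ler_pM2l// -powRM// ?sqrtr_ge0//.
  apply: ge0_ler_powR; rewrite ?nnegrE ?mulr_ge0 ?sqrtr_ge0 ?(ltW b0)//.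
  rewrite -(ler_pXn2r (n := 2)) ?nnegrE ?mulr_ge0 ?sqrtr_ge0//.
  rewrite exprMn !sqr_enorm.
  have := dotp_ge0 (eta *: x + (-1) *: y).
  rewrite -[- y]scaleN1r (dotp_sqrD (eta *: x)) (dotp_sqrD x) !dotpZl !dotpZr
    -!sqr_enorm.
  move: xe; rewrite ltr_pdivrMr// => xe.
  have ny0 : 0 <= enorm y by exact: sqrtr_ge0.
  have yx : enorm y ^+ 2 <= (enorm x * eta) ^+ 2.
    by rewrite ler_pXn2r ?nnegrE// ltW// (le_lt_trans ny0).
  move=> H; rewrite -(ler_pM2l eta0).
  have Eth : th ^+ 2 = 1 - 2 * eta by rewrite /eta; field.
  rewrite Eth.
  rewrite exprMn in yx.
  have Y0 : 0 <= enorm y ^+ 2 := sqr_ge0 _.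
  have eY : 0 <= eta * enorm y ^+ 2 by rewrite mulr_ge0 ?(ltW eta0).
  move: (dotp x y) (enorm x ^+ 2) (enorm y ^+ 2) H yx Y0 eY => d X Y *.
  lra.
have [z _ zmax] : exists2 z, z \in [set x : 'rV[R]_n | enorm x <= R1] &
   forall x, x \in [set x : 'rV[R]_n | enorm x <= R1] ->
    u x - c * enorm (x - y) `^ beta <= u z - c * enorm (z - y) `^ beta.
  apply: EVT_max_rV.
  - by exists y; rewrite /= /R1 !le_max lexx orbT.
  - exact: compact_enorm_ball.
  - apply: continuous_subspaceT => x.
    have ck : {for x, continuous (fun _ : 'rV[R]_n => c)} by exact:
      cst_continuous.
    exact: (continuousB (cu x) (continuousM ck (@enorm_powR_continuous _ y b0
      x))).
exists z => x; have [xR|xR] := leP (enorm x) R1; first by apply: zmax;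
  rewrite inE.
(* By the choice of [R1] the ball contains [y], where the difference is [u y >= 0]; outside the ball
   it is at most 0, so the maximum over the ball is global. *)
have := zmax y; rewrite inE /= /R1 !le_max lexx orbT => /(_ isT).
rewrite subrr [enorm 0]/enorm dotp0 sqrtr0 powR0 ?gt_eqF// mulr0 subr0 => H.
apply: le_trans H; apply: le_trans (u0 y); rewrite subr_le0; exact: far.
Qed.

(* Chaining the estimate along [N] equal steps costs [N * (d / N) `^ beta],
   which vanishes as [N] grows since [1 < beta]. *)
Lemma local_max_of_holder u z (beta c : R) :
  continuous u -> 0 < u z -> 1 < beta -> 0 < c ->
  (forall y, 0 < u y -> forall x, u x <= u y + c * enorm (x - y) `^ beta) ->
  \forall x \near z, u x <= u z.
Proof.
move=> cu uz b1 c0 holder.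
(* The estimate is only available from points where [u] is positive, so the chain has to stay in a
   ball of positivity. *)
have /nbhs_eball[r r0 upos] : \forall x \near z, 0 < u x.
  have /cvgrPdist_lt/(_ _ uz) := cu z.
  by apply: filterS => x; rewrite /= ltr_distl; lra.
have : nbhs z (eball z r).
  have /cvgrPdist_lt/(_ _ r0) := @enorm_dist_continuous z z.
  apply: filterS => t; rewrite /eball /= subrr [enorm 0]/enorm dotp0 sqrtr0
    sub0r normrN.
  by rewrite ger0_norm ?sqrtr_ge0.
apply: filterS => x xr.
pose d := enorm (x - z).
have d0 : 0 <= d by exact: sqrtr_ge0.
have chain N : (0 < N)%N -> forall k, (k <= N)%N ->
    u (z + (k%:R / N%:R) *: (x - z)) <= u z + k%:R * (c * (d / N%:R) `^ beta).
  move=> N0; have N0' : (0 : R) < N%:R by rewrite ltr0n.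
  elim=> [|k IH] kN; first by rewrite !mul0r scale0r !addr0.
  have upk : 0 < u (z + (k%:R / N%:R) *: (x - z)).
    apply: upos; rewrite /eball /= addrC addKr /enorm dotpZl dotpZr mulrA
      -expr2.
    rewrite sqrtrM ?sqr_ge0// sqrtr_sqr ger0_norm ?divr_ge0//.
    apply: le_lt_trans xr; rewrite ler_piMl ?sqrtr_ge0//.
    by rewrite ler_pdivrMr// mul1r ler_nat ltnW.
  apply: le_trans (holder _ upk _) _.
  rewrite [X in enorm X](_ : _ = N%:R^-1 *: (x - z)); last first.
    rewrite opprD addrACA subrr add0r -scalerBl; congr (_ *: _).
    by rewrite -mulrBl -natrB ?leqnSn// subSnn mul1r.
  have -> : enorm (N%:R^-1 *: (x - z)) = d / N%:R.
    rewrite /enorm dotpZl dotpZr mulrA -expr2 sqrtrM ?sqr_ge0// sqrtr_sqr.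
    by rewrite ger0_norm ?invr_ge0 ?(ltW N0')// mulrC.
  have := IH (ltnW kN); rewrite -natr1 mulrDl mul1r; lra.
rewrite leNgt; apply/negP => gap.
pose dl := u x - u z.
have dl0 : 0 < dl by rewrite /dl subr_gt0.
(* The total cost of [N] steps is c d^beta / N^(beta - 1); it falls below the gap [dl] once N^(beta
   - 1) > A. *)
pose A := c * d `^ beta / dl.
have A0 : 0 <= A by rewrite divr_ge0 ?mulr_ge0 ?powR_ge0 ?(ltW c0) ?(ltW dl0).
pose N := (Num.bound (A `^ (beta - 1)^-1)).+1.
have Nb : A < N%:R `^ (beta - 1).
  have b10 : 0 < beta - 1 by lra.
  have : A `^ (beta - 1)^-1 < N%:R.
    by apply: lt_trans (archi_boundP (powR_ge0 _ _)) _; rewrite ltr_nat.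
  move=> /(gt0_ltr_powR b10); rewrite -powRrM mulVf ?gt_eqF// powRr1//; apply.
    by rewrite nnegrE powR_ge0.
  by rewrite nnegrE.
have N0 : (0 : R) < N%:R by rewrite ltr0n.
have := chain N (ltn0Sn _) N (leqnn _).
rewrite divff ?gt_eqF// scale1r addrC subrK.
rewrite powRM ?invr_ge0 ?(ltW N0)//.
have -> : N%:R^-1 `^ beta = (N%:R * N%:R `^ (beta - 1))^-1.
  rewrite -powR_inv1 ?(ltW N0)// -powRrM mulN1r powRN; congr (_^-1).
  by rewrite mulr_powRB1 ?(ltW N0)//; lra.
have P0 : 0 < N%:R `^ (beta - 1) by rewrite powR_gt0.
rewrite (_ : N%:R * _ = A * dl / N%:R `^ (beta - 1)); last first.
  by rewrite /A; field; rewrite !gt_eqF.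
have : A * dl / N%:R `^ (beta - 1) < dl.
  by rewrite ltr_pdivrMr// [ltRHS]mulrC ltr_pM2r.
rewrite /dl; lra.
Qed.

End Global.

(** * The growth condition, the critical constant and the conclusion *)

Lemma limf_esup_at_infty_lt (R : realType) (n : nat) (g : 'rV[R]_n -> R)
    (l : R) :
  (limf_esup (fun x => (g x)%:E) (at_infty R n) < l%:E)%E ->
  exists2 l', l' < l & exists r, forall x, r < enorm x -> g x <= l'.
Proof.
(* The limit superior is an infimum of suprema over sets of the filter, so a strict bound is already
   attained by one set [A]. *)
move=> /ereal_inf_lt[_ [A [r _ rA] <-]] supl.
have ub l' : (ereal_sup [set (g x)%:E | x in A] <= l'%:E)%E ->
    exists r, forall x, r < enorm x -> g x <= l'.
  move=> sl; exists r => x rx; rewrite -lee_fin; apply: le_trans sl.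
  by apply: ereal_sup_ubound; exists x => //; exact: rA.
case: (ereal_sup _) supl ub => [s| |]//=.
  by rewrite lte_fin => sl /(_ s (lexx _)) H; exists s.
(* The supremum is minus infinity, as for empty [A]; any number below [l] serves. *)
by move=> _ /(_ (l - 1) (leNye _)) H; exists (l - 1) => //; lra.
Qed.

(* [c |x|^beta] with [beta = (gamma+2)/(gamma+1-m)] has an operator value
   proportional to its own [m]-th power. *)
Lemma power_barrier_scaling (R : realType) (gamma m beta c r : R) :
  0 < beta -> 0 < c -> 0 < r -> beta * (gamma + 1 - m) = gamma + 2 ->
  (c * r `^ beta * beta / r) `^ gamma * (c * r `^ beta * beta / r ^+ 2) =
  (c * r `^ beta) `^ m * (c `^ (gamma + 1 - m) * beta `^ (gamma + 1)).
Proof.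
move=> b0 c0 r0 E; have p0 : 0 < r `^ beta by rewrite powR_gt0.
have C0 : 0 < c * r `^ beta by rewrite mulr_gt0.
have s0 : 0 < r ^+ 2 by rewrite exprn_gt0.
have q0 : 0 < c * r `^ beta * beta / r by rewrite divr_gt0 ?mulr_gt0.
have t0 : 0 < c * r `^ beta * beta / r ^+ 2 by rewrite divr_gt0 ?mulr_gt0.
(* On logarithms the identity is linear in ln c, ln beta and ln r; the coefficients of ln r agree by
   the hypothesis [E]. *)
apply: ln_inj.
- by rewrite posrE mulr_gt0 ?powR_gt0.
- by rewrite posrE mulr_gt0 ?mulr_gt0 ?powR_gt0.
have LM (x y : R) : 0 < x -> 0 < y -> ln (x * y) = ln x + ln y.
  by move=> x0 y0; rewrite lnM.
have LD (x y : R) : 0 < x -> 0 < y -> ln (x / y) = ln x - ln y.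
  by move=> x0 y0; rewrite ln_div.
have LC : ln (c * r `^ beta) = ln c + beta * ln r by rewrite LM ?ln_powR.
have Cb : 0 < c * r `^ beta * beta by rewrite mulr_gt0.
rewrite [in LHS]LM ?powR_gt0// ln_powR !LD// lnXn// mulr2n (LM _ beta)// LC.
rewrite [in RHS]LM ?mulr_gt0 ?powR_gt0// ln_powR LC LM ?powR_gt0// !ln_powR.
have := congr1 (fun t => t * ln r) E; lra.
Qed.

Theorem theorem1p14 (R : realType) (n : nat) (hn : (0 < n)%N)
  (p gamma m beta lambda0 Lambda0 : R)
  (hp : 1 < p) (hgamma : -1 < gamma) (hm0 : 0 <= m) (hm1 : m < gamma + 1)
  (hbeta : beta = (gamma + 2) / (gamma + 1 - m))
  (a : 'rV[R]_n -> R) (ha : continuous a)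
  (hlambda0 : 0 < lambda0)
  (hab : forall x, lambda0 <= a x <= Lambda0)
  (u : 'rV[R]_n -> R) (hu0 : forall x, 0 <= u x)
  (hu : viscosity_solution p gamma
          (fun x s => a x * Num.max s 0 `^ m) setT u)
  (hlim : (limf_esup (fun x => (u x / enorm x `^ beta)%:E) (at_infty R n)
    < ((beta `^ ((gamma + 1) / (gamma + 1 - m)))^-1 *
       (lambda0 / (n%:R - 1 + (p - 1) * (beta - 1)))
         `^ (gamma + 1 - m)^-1)%:E)%E) :
  forall x, u x = 0.
Proof.
set q := gamma + 1 - m in hbeta hlim.
set K := n%:R - 1 + _ in hlim; set cs := _ * _ in hlim.
have q0 : 0 < q by rewrite /q; lra.
have bq : beta * q = gamma + 2 by rewrite hbeta divfK// gt_eqF.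
have b1 : 1 < beta by rewrite hbeta ltr_pdivlMr// /q; lra.
have b0 : 0 < beta by lra.
have n1 : (1 : R) <= n%:R by rewrite ler1n.
have K0 : 0 < K by rewrite /K; nra.
have cs0 : 0 < cs by rewrite mulr_gt0 ?invr_gt0 ?powR_gt0 ?divr_gt0.
(* This characterizes the critical constant: away from the origin, cs |x|^beta solves the equation
   with [a] replaced by [lambda0]. *)
have csE : cs `^ q * beta `^ (gamma + 1) * K = lambda0.
  rewrite powRM ?invr_ge0 ?powR_ge0// -powRrM mulVf ?gt_eqF//.
  rewrite powRr1 ?divr_ge0 ?(ltW hlambda0) ?(ltW K0)//.
  rewrite -powRN -powRrM mulNr divfK ?gt_eqF// powRN; field.
  by rewrite gt_eqF//= gt_eqF// powR_gt0.
have [su _] := hu; have [cu _] := su.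
have {}cu : continuous u by move=> x; exact: cu.
have [c1 c1cs [R1 uR1]] := limf_esup_at_infty_lt hlim.
(* The bound [c1] may be negative; the maximum with [cs / 2] makes [c0] positive and keeps it below
   [cs]. *)
pose c0 := Num.max c1 (cs / 2); pose c := (c0 + cs) / 2.
have c00 : 0 < c0 by rewrite lt_max divr_gt0 ?orbT.
have c0cs : c0 < cs by rewrite gt_max c1cs; lra.
have c0c : c0 < c by rewrite /c; lra.
have cp : 0 < c by lra.
have ccs : c < cs by rewrite /c; lra.
have ub x : Num.max R1 0 < enorm x -> u x <= c0 * enorm x `^ beta.
  rewrite gt_max => /andP[/uR1 H x0]; rewrite -ler_pdivrMr ?powR_gt0//.
  by apply: le_trans H _; rewrite le_max lexx.
pose k := c `^ q * beta `^ (gamma + 1).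
have k0 : 0 < k by rewrite mulr_gt0 ?powR_gt0.
have kK : k * K < lambda0.
  rewrite -csE ltr_pM2r// ltr_pM2r ?powR_gt0//.
  by apply: gt0_ltr_powR => //; rewrite nnegrE ltW.
(* Chosen so that k n eps is half the gap between [k * K] and [lambda0]. *)
pose eps := (lambda0 - k * K) / (2 * k * n%:R).
have n0 : (0 : R) < n%:R by lra.
have eps0 : 0 < eps by rewrite divr_gt0 ?subr_gt0 ?(mulr_gt0 (mulr_gt0 _ k0)).
have strict : k * ((n%:R - 1) * (1 + eps) + (p - 1) * (beta - 1)) < lambda0.
  have -> : k * ((n%:R - 1) * (1 + eps) + (p - 1) * (beta - 1)) =
            k * K + k * n%:R * eps - k * eps by rewrite /K; ring.
  have -> : k * n%:R * eps = (lambda0 - k * K) / 2 by rewrite /eps; field;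
    rewrite !gt_eqF.
  have : 0 < k * eps by rewrite mulr_gt0.
  lra.
have holder y : 0 < u y -> forall x, u x <= u y + c * enorm (x - y) `^ beta.
  move=> uy; have [z zmax] := power_barrier_max y cu hu0 b0 c00 c0c ub.
  have yE : enorm (y - y) `^ beta = 0.
    by rewrite subrr /enorm dotp0 sqrtr0 powR0 ?gt_eqF.
  have [zy|zy] := eqVneq z y.
    by move=> x; have := zmax x; rewrite zy yE mulr0 subr0; lra.
  have zmax' : \forall x \near z,
      u x - c * enorm (x - y) `^ beta <= u z - c * enorm (z - y) `^ beta.
    by near=> x; exact: zmax.
  have := subsolution_touching_power su zy cp b0 eps0 zmax'.
  set r := enorm (z - y) => touch.
  have r0 : 0 < r by rewrite /r enorm_gt0 subr_eq0.
  have C0 : 0 < c * r `^ beta by rewrite mulr_gt0 ?powR_gt0.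
  have Cm : 0 < (c * r `^ beta) `^ m by rewrite powR_gt0.
  (* Maximality compared at [y] gives u z - c r^beta >= u y > 0, so the right-hand side of the
     equation at [z] dominates the one evaluated at the barrier. *)
  have Cu : c * r `^ beta <= u z by have := zmax y; rewrite yE mulr0 subr0; lra.
  have /andP[la _] := hab z.
  have low : lambda0 * (c * r `^ beta) `^ m <= a z * Num.max (u z) 0 `^ m.
    apply: ler_pM; rewrite ?powR_ge0// ?(ltW hlambda0)//.
    by apply: ge0_ler_powR; rewrite // ?nnegrE ?le_max ?hu0 ?(ltW C0) ?Cu.
  have := le_trans low touch.
  rewrite (power_barrier_scaling b0 cp r0 bq) -/q -/k -mulrA [leLHS]mulrC
    ler_pM2l//.
  by rewrite leNgt strict.
move=> x; apply/eqP; rewrite eq_le hu0 andbT leNgt; apply/negP => ux.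
have := subsolution_local_max hn hp hgamma su (local_max_of_holder cu ux b1 cp
  holder).
rewrite max_l// leNgt => /negP; apply; rewrite mulr_gt0 ?powR_gt0//.
by have /andP[] := hab x; lra.
Unshelve. all: by end_near. Qed.
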